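(* Assume the Continuum Hypothesis. Then the set $\operatorname{Sch}^{\mathrm{p}}(\mathbb Z)$ is dense in $\operatorname{Sch}(\mathbb Z)$.
   Context: For a set $X$, $\beta(X)$ denotes the set of all ultrafilters on $X$, with the topology generated by the base $\{\langle A\rangle : A\subseteq X\}$, where $\langle A\rangle=\{u\in\beta(X): A\in u\}$. An ultrafilter is free if the intersection of all its members is empty. An ultrafilter $u$ on the group $(\mathbb Z,+)$ is called Schur if for each $U\in u$ there exist $a,b\in U$ with $a+b\in U$. An ultrafilter $u$ on a countable set is a P-point if for every countable family $\{U_n:n\in\mathbb N\}\subseteq u$ there exists $U\in u$ with $U\subseteq^* U_n$ (i.e. $U\setminus U_n$ finite) for all $n$. $\operatorname{Sch}(\mathbb Z)$ is the subspace of $\beta(\mathbb Z)$ consisting of all free Schur ultrafilters on $\mathbb Z$, and $\operatorname{Sch}^{\mathrm{p}}(\mathbb Z)$ is the set of all free Schur ultrafilters on $\mathbb Z$ that are P-points. *)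

(* Defs.v *)
From HB Require Import structures.
From mathcomp Require Import all_boot all_order all_algebra.
From mathcomp Require Import boolp classical_sets functions cardinality filter.
From mathcomp Require Import topology.

Set Implicit Arguments.
Unset Strict Implicit.
Unset Printing Implicit Defensive.

Local Open Scope classical_set_scope.

(* No cardinality lies strictly between those of nat and its powerset. *)
Definition continuum_hypothesis : Prop :=
  forall A : set (set nat), countable A \/ (A #= [set: set nat])%card.

(* The points of beta(X). *)
Record ultrafilter (X : Type) : Type := Ultrafilter {
  members :> set_system X;
  members_ultra : UltraFilter members
}.
Arguments Ultrafilter {X} members members_ultra.
#[export] Existing Instance members_ultra.

HB.instance Definition _ (X : Type) := gen_eqMixin (ultrafilter X).
HB.instance Definition _ (X : Type) := gen_choiceMixin (ultrafilter X).

Definition ultrafilters_containing (X : Type) (A : set X) :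
  set (ultrafilter X) := [set u | members u A].

Lemma ultrafilters_containing_cover (X : Type) :
  \bigcup_(A in [set: set X]) ultrafilters_containing A = setT.
Proof. by apply/seteqP; split=> // u _; exists setT => //; exact: filterT. Qed.

Lemma ultrafilters_containing_join (X : Type) (A B : set X)
    (u : ultrafilter X) :
  [set: set X] A -> [set: set X] B ->
  ultrafilters_containing A u -> ultrafilters_containing B u ->
  exists C, [/\ [set: set X] C, ultrafilters_containing C u &
    ultrafilters_containing C `<=`
      ultrafilters_containing A `&` ultrafilters_containing B].
Proof.
move=> _ _ uA uB; exists (A `&` B); split => //; first exact: filterI.
by move=> v vAB; split; apply: filterS vAB; [exact: subIsetl|exact: subIsetr].
Qed.

HB.instance Definition _ (X : Type) :=
  isBaseTopological.Build (ultrafilter X)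
    (@ultrafilters_containing_cover X) (@ultrafilters_containing_join X).

Definition free_ultrafilter (X : Type) (u : ultrafilter X) : Prop :=
  \bigcap_(A in members u) A = set0.

(* [a] and [b] are allowed to be equal. *)
Definition schur_ultrafilter (u : ultrafilter int) : Prop :=
  forall U : set int, members u U ->
    exists a b : int, [/\ U a, U b & U (a + b)%R].

Definition p_point (X : countType) (u : ultrafilter X) : Prop :=
  forall U_ : nat -> set X, (forall n, members u (U_ n)) ->
    exists2 U : set X, members u U & forall n, finite_set (U `\` U_ n).

Definition Sch : set (ultrafilter int) :=
  [set u | free_ultrafilter u /\ schur_ultrafilter u].

Definition Schp : set (ultrafilter int) :=
  [set u | [/\ free_ultrafilter u, schur_ultrafilter u & p_point u]].

(* Main.v *)
(** Call [A] large when every finite colouring of the integers has a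
    monochromatic triple [a, b, a + b] in [A] with [a <> 0].  Members of free
    Schur ultrafilters are large; an ultrafilter all of whose members are large
    is free and Schur.  Large sets form a coideal containing no finite set, and
    by compactness a set large for [k] colours has a finite subset large for
    [k] colours, so a countable chain of large sets modulo finite has a large
    pseudo-intersection (a union of finite pieces, the [k]-th one large for [k]
    colours).  Under CH one therefore builds, along a well-order with countable
    initial segments, a tower of large sets below a given one which decides
    every sequence [X] of sets: some member of the tower is almost contained in
    all the [X n], or is disjoint from a finite intersection of them.  Such a
    tower generates a Schur P-point. *)
Require Import Defs.
From mathcomp Require Import all_boot all_order all_algebra.
From mathcomp Require Import boolp classical_sets functions cardinality filter.
From mathcomp Require Import topology.
From mathcomp Require wochoice.

Set Implicit Arguments.
Unset Strict Implicit.
Unset Printing Implicit Defensive.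

Local Open Scope classical_set_scope.

(** * Inclusion modulo finite sets *)

Definition almost_subset (T : Type) (A B : set T) : Prop :=
  finite_set (A `\` B).

Lemma almost_subset_trans (T : Type) (A B C : set T) :
  almost_subset A B -> almost_subset B C -> almost_subset A C.
Proof.
move=> AB BC; have ABC : finite_set ((A `\` B) `|` (B `\` C)).
  by rewrite finite_setU.
apply: sub_finite_set ABC => x [Ax nCx].
by have [Bx|nBx] := pselect (B x); [right|left].
Qed.

Lemma sub_almost_subset (T : Type) (A B : set T) :
  A `<=` B -> almost_subset A B.
Proof. by rewrite /almost_subset -setD_eq0 => ->; exact: finite_set0. Qed.

Lemma almost_subsetI (T : Type) (A B C : set T) :
  almost_subset A B -> almost_subset A C -> almost_subset A (B `&` C).
Proof. by rewrite /almost_subset setDIr finite_setU. Qed.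

(** * Finite colourings and large sets *)

Lemma ultra_finite_color (X : Type) (F : set_system X) (FU : UltraFilter F)
    (I : finType) (c : X -> I) : exists i, F [set x | c x = i].
Proof.
apply: contrapT => /forallNP noF.
have /filter_forall /filter_ex[x] : forall i, F [set x | c x <> i].
  by move=> i; have [/noF//|] := in_ultra_setVsetC [set x | c x = i] FU.
by move/(_ (c x)).
Qed.

(** Without [a <> 0] the triple 0, 0, 0 would make the singleton of 0 large; triples a, 0, a are
    defeated by a colouring that separates 0 from the rest. *)
Definition mono_schur (T : Type) (A : set int) (c : int -> T) : Prop :=
  exists a b : int, [/\ a <> 0%R, A a, A b, A (a + b)%R &
    c b = c a /\ c (a + b)%R = c a].

Definition schur_large (A : set int) : Prop :=
  forall (T : finType) (c : int -> T), mono_schur A c.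

Lemma schur_largeS (A B : set int) :
  A `<=` B -> schur_large A -> schur_large B.
Proof.
move=> AB lA T c; have [a [b [a0 /AB ? /AB ? /AB ? cc]]] := lA T c.
by exists a, b.
Qed.

(** Bad colourings of the two halves, combined with membership in [B], would give a bad colouring of
    [A]. *)
Lemma schur_large_split (A B : set int) :
  schur_large A -> schur_large (A `&` B) \/ schur_large (A `\` B).
Proof.
move=> lA; apply: contrapT => /not_orP[].
move=> /existsNP[T1 /existsNP[c1 H1]] /existsNP[T2 /existsNP[c2 H2]].
have [a [b [a0 Aa Ab Aab [[eb e1 e2] [eab f1 f2]]]]] :=
  lA (bool * T1 * T2)%type (fun x => (`[< B x >], c1 x, c2 x)).
have [Ba|nBa] := pselect (B a).
  have Bb : B b by apply: asboolW; rewrite eb asboolT.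
  have Bab : B (a + b)%R by apply: asboolW; rewrite eab asboolT.
  by apply: H1; exists a, b.
have Bb : ~ B b by move=> /asboolT; rewrite eb => /asboolW.
have Bab : ~ B (a + b)%R by move=> /asboolT; rewrite eab => /asboolW.
by apply: H2; exists a, b.
Qed.

(* A colouring injective on [A] forces [a = b = a + b], hence [a = 0]. *)
Lemma finite_not_schur_large (A : set int) : finite_set A -> ~ schur_large A.
Proof.
move=> /finite_seqP[s ->] ls.
pose c x : 'I_(size s).+1 := inord (index x s).
have cI x y : x \in s -> c x = c y -> x = y.
  move=> xs /(congr1 val); rewrite /= !inordK ?ltnS ?index_size// => xy.
  have ys : y \in s by rewrite -index_mem -xy index_mem.
  by rewrite -(nth_index 0%R xs) xy nth_index.
have [a [b [a0 /= As Bs ABs [/(cI _ _ Bs) eb /(cI _ _ ABs)]]]] := ls _ c.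
by rewrite eb => /(canRL (GRing.addrK _)); rewrite GRing.subrr.
Qed.

Lemma schur_large_almost (A B : set int) :
  almost_subset A B -> schur_large A -> schur_large B.
Proof.
move=> AB /(@schur_large_split _ B)[|/(finite_not_schur_large AB)//].
by apply: schur_largeS; exact: subIsetr.
Qed.

Lemma schur_large_ultrafilter (u : ultrafilter int) (A : set int) :
  Sch u -> members u A -> schur_large A.
Proof.
move=> [uf us] uA T c.
have [i ui] := ultra_finite_color (members_ultra u) c.
have u0 : members u (~` [set 0%R]).
  have [u0|//] := in_ultra_setVsetC [set 0%R] (members_ultra u).
  (* If the singleton of 0 were in [u], then 0 would lie in every member, against freeness. *)
  suff : set0 (0 : int)%R by [].
  rewrite -uf => B uB; have [x [Bx <-]] := filter_ex (filterI uB u0).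
  exact: Bx.
have [a [b [[/= [ca a0] Aa] [[cb b0] Ab] [[cab ab0] Aab]]]] :=
  us _ (filterI (filterI ui u0) uA).
by exists a, b; split => //; rewrite cb cab ca.
Qed.

(* Otherwise each [N] has a bad colouring [c N], and their limit along a free
   ultrafilter on [nat] is a bad colouring of [A]. *)
Lemma schur_large_compact (A : set int) (k : nat) : schur_large A ->
  exists N, forall c : int -> 'I_k,
    mono_schur (A `&` [set x | pickle x <= N]) c.
Proof.
move=> lA; apply: contrapT => /forallNP H.
have {H} H N : exists c : int -> 'I_k,
    ~ mono_schur (A `&` [set x | pickle x <= N]) c.
  exact/existsNP/H.
have [c bad] := choice H.
have [W [WU sW]] := ultraFilterLemma (eventually_filter : ProperFilter \oo).
have [l lP] := choice (fun x => ultra_finite_color WU (c^~ x)).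
have [a [b [a0 Aa Ab Aab [lb lab]]]] := lA _ l.
pose N0 := maxn (pickle a) (maxn (pickle b) (pickle (a + b)%R)).
have WN : W [set N | N0 <= N] by apply: sW; exists N0.
have [N [[[ca cb] cab]]] := filter_ex
  (filterI (filterI (filterI (lP a) (lP b)) (lP (a + b)%R)) WN).
rewrite /= !geq_max => /and3P[Na Nb Nab].
by apply: (bad N); exists a, b; split => //=; rewrite ca cb cab.
Qed.

(** * Pseudo-intersections of chains of large sets *)

Lemma mono_schur_inj (T U : Type) (f : T -> U) (A : set int) (c : int -> T) :
  injective f -> mono_schur A (f \o c) -> mono_schur A c.
Proof.
by move=> fI [a [b [a0 ? ? ? [/fI ? /fI ?]]]]; exists a, b.
Qed.

Lemma schur_large_decreasing (A : nat -> set int) :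
  (forall m n, m <= n -> A n `<=` A m) -> (forall n, schur_large (A n)) ->
  exists2 P, schur_large P & forall n, almost_subset P (A n).
Proof.
move=> decA lA.
have [N NP] := choice (fun k => schur_large_compact k (lA k)).
(* The [k]-th piece serves [k] colours; pieces with [k >= n] lie in [A n], so only the first [n] can
   leave it. *)
exists (\bigcup_k (A k `&` [set x | pickle x <= N k])) => [T c|n].
  apply: (mono_schur_inj enum_rank_inj).
  have [a [b [a0 Aa Ab Aab cc]]] := NP #|T| (enum_rank \o c).
  by exists a, b; split => //; exists #|T|.
have fin : finite_set (\bigcup_(k in `I_n) [set x : int | pickle x <= N k]).
  apply: bigcup_finite => // k _.
  apply: (sub_finite_set (B := pickle @^-1` `I_(N k).+1)).
    by move=> x /=; rewrite ltnS.
  by apply: finite_preimage => // x y _ _; exact: pcan_inj pickleK x y.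
apply: sub_finite_set fin => x [[k _ [Akx xN]] nAn]; exists k => //=.
by rewrite ltnNge; apply/negP => /decA /(_ _ Akx).
Qed.

Lemma schur_large_pseudo_intersection (G : set (set int)) :
  countable G -> G !=set0 ->
  (forall A B, G A -> G B -> almost_subset A B \/ almost_subset B A) ->
  (forall A, G A -> schur_large A) ->
  exists2 P, schur_large P & forall A, G A -> almost_subset P A.
Proof.
move=> /pfcard_geP[-> [] //|[e] _ chainG lG].
have Ge n : G (e n) by exact: funS.
(* The smallest modulo finite of the first sets is almost contained in their intersection, which is
   therefore large. *)
have minB n : exists m, almost_subset (e m) (\bigcap_(k in `I_n) e k).
  elim: n => [|n [m mB]].
    by exists 0; apply: sub_almost_subset => x _ k /=; rewrite ltn0.
  have -> : \bigcap_(k in `I_n.+1) e k = e n `&` \bigcap_(k in `I_n) e k.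
    by rewrite IIS bigcap_setU bigcap_set1 setIC.
  have [le|le] := chainG _ _ (Ge n) (Ge m).
    exists n; apply: almost_subsetI (almost_subset_trans le mB).
    exact: sub_almost_subset.
  by exists m; apply: almost_subsetI.
have [|n|P lP PB] := @schur_large_decreasing (fun n => \bigcap_(k in `I_n) e k).
- by move=> m n mn x Bx k /= km; apply: Bx; exact: leq_trans km mn.
- by have [m mB] := minB n; apply: schur_large_almost mB (lG _ (Ge m)).
exists P => // A GA; have [n _ <-] : range e A by exact: surj.
apply: almost_subset_trans (PB n.+1) _; apply: sub_almost_subset => x.
by apply => /=.
Qed.

(** * Deciding sequences along a well-order *)

Definition decides (T : set int) (X : nat -> set int) : Prop :=
  (forall n, almost_subset T (X n)) \/
  exists n, T `<=` ~` \bigcap_(k in `I_n) X k.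

(** If no [P \ B n] is large, splitting makes every [P & B n] large, and a pseudo-intersection of
    these works. *)
Lemma schur_large_decide (P : set int) (X : nat -> set int) : schur_large P ->
  exists T, [/\ schur_large T, almost_subset T P & decides T X].
Proof.
move=> lP; pose B n := \bigcap_(k in `I_n) X k.
have [[n ln]|/forallNP nl] := pselect (exists n, schur_large (P `\` B n)).
  exists (P `\` B n); split => //; first exact: sub_almost_subset.
  by right; exists n; exact: subIsetr.
have [|n|T lT TB] := @schur_large_decreasing (fun n => P `&` B n).
- move=> m n mn x [Px Bx]; split => // k /= km; apply: Bx.
  exact: leq_trans km mn.
- by have [|/nl] := schur_large_split (B n) lP.
exists T; split => //.
  by apply: almost_subset_trans (TB 0) _; apply: sub_almost_subset.
left => n; apply: almost_subset_trans (TB n.+1) _.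
by apply: sub_almost_subset => x [_]; apply => /=.
Qed.

(* [D] is the whole type if all its initial segments are countable, and
   otherwise the least uncountable one, of size continuum by CH. *)
Lemma ch_well_order (CH : continuum_hypothesis) :
  exists (lt : set nat -> set nat -> Prop) (D : set (set nat)),
  [/\ well_founded lt, forall x y, [\/ lt x y, x = y | lt y x],
      (D #= [set: set nat])%card &
      forall x, D x -> countable [set y | D y /\ lt y x]].
Proof.
have [R wo] := wochoice.well_ordering_principle (set nat).
have minR (A : set (set nat)) x :
    A x -> exists2 z, A z & forall y, A y -> R z y.
  move=> Ax; have [|z [[/asboolP Az zA] _]] := wo (fun x => `[< A x >]).
    by exists x; exact/asboolP.
  by exists z => // y Ay; apply: zA; exact/asboolP.
pose lt x y := ~~ R y x.
have wf : well_founded lt.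
  move=> x; apply: contrapT => nx.
  have [z nz zmin] := minR [set x | ~ Acc lt x] x nx.
  by apply: nz; split => y; apply: contraNP => /zmin.
have tot x y : [\/ lt x y, x = y | lt y x].
  rewrite /lt; have [Ryx|_] := boolP (R y x); last by constructor 1.
  have [Rxy|_] := boolP (R x y); last by constructor 3.
  (* Here [x] and [y] precede each other, so both are least in the pair, and least elements are
     unique. *)
  constructor 2; have [|z [_ zu]] := wo (pred2 x y).
    by exists x; rewrite -topredE /= eqxx.
  have Rr t : R t t.
    by have [//|w ->] := minR [set t] t; apply.
  rewrite -(zu x) ?(zu y)//; split; rewrite -?topredE /= ?eqxx ?orbT//.
    by move=> t; rewrite -topredE => /pred2P[] ->.
  by move=> t; rewrite -topredE => /pred2P[] ->.
have [call|/existsNP[x0 nx0]] := pselect (forall x, countable [set y | lt y x]).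
  exists lt, setT; split => // x _.
  by apply: sub_countable (call x); apply: subset_card_le => y [].
have [x nx xmin] := minR [set x | ~ countable [set y | lt y x]] _ nx0.
exists lt, [set y | lt y x]; split => // [|y yx].
  by have [/nx|] := CH [set y | lt y x].
apply: (@sub_countable _ _ _ [set z | lt z y]).
  by apply: subset_card_le => z [].
by move: yx; apply: contraNP => /xmin.
Qed.

(** The recursion continues at [x] because the earlier stages form a countable chain modulo finite;
    a pseudo-intersection of it is then shrunk to decide [X x]. *)
Lemma schur_tower (lt : set nat -> set nat -> Prop) (D : set (set nat))
    (X : set nat -> nat -> set int) (A : set int) :
  well_founded lt -> (forall x y, [\/ lt x y, x = y | lt y x]) ->
  (forall x, D x -> countable [set y | D y /\ lt y x]) ->
  schur_large A ->
  exists g : set nat -> set int, forall x, D x ->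
    [/\ schur_large (g x), almost_subset (g x) A, decides (g x) (X x) &
        forall y, D y -> lt y x -> almost_subset (g x) (g y)].
Proof.
move=> wf tot Dseg lA.
pose good x (prev : forall y, lt y x -> set int) T :=
  [/\ schur_large T, almost_subset T A, decides T (X x) &
    forall y (yx : lt y x), D y -> almost_subset T (prev y yx)].
(* The default [A] never occurs at stages in [D], as [gP] shows. *)
pose step x prev := xget A [set T | good x prev T].
pose g := Fix wf (fun=> set int) step.
have gE x : g x = step x (fun y _ => g y).
  apply: (Fix_eq wf (fun=> set int) step) => {}x f h fh; congr step.
  by apply: functional_extensionality_dep => y; apply: funext => yx; exact: fh.
have gP x : D x -> good x (fun y _ => g y) (g x).
  elim/(well_founded_ind wf): x => x IH Dx.
  rewrite [in X in good _ _ X]gE; apply: xgetPex.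
  (* Including [A] makes the family nonempty even at the first stage. *)
  pose G := A |` [set g y | y in [set y | D y /\ lt y x]].
  have [|||B|P lP PG] := @schur_large_pseudo_intersection G.
  - rewrite /G -bigcup2E; apply: bigcup_countable => // -[|[|n]] _ //=.
    exact: sub_countable (card_image_le _ _) (Dseg x Dx).
  - by exists A; left.
  - move=> _ _ [->|[y [Dy yx] <-]] [->|[z [Dz zx] <-]].
    + by left; exact: sub_almost_subset.
    + by right; have [] := IH z zx Dz.
    + by left; have [] := IH y yx Dy.
    + have [yz|->|zy] := tot y z.
      * by right; have [_ _ _ /(_ y yz Dy)] := IH z zx Dz.
      * by left; exact: sub_almost_subset.
      * by left; have [_ _ _ /(_ z zy Dz)] := IH y yx Dy.
  - by move=> [->//|[y [Dy yx] <-]]; have [] := IH y yx Dy.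
  have [T [lT TP dT]] := schur_large_decide (X x) lP.
  exists T; split => // [|y yx Dy]; apply: almost_subset_trans TP (PG _ _).
    by left.
  by right; exists y.
exists g => x /gP[lg gA dg gy]; split => // y Dy yx; exact: gy.
Qed.

(** * The ultrafilter generated by a tower *)

Lemma schur_tower_ultrafilter (CH : continuum_hypothesis) (A : set int) :
  schur_large A -> exists2 v : ultrafilter int, members v A & Schp v.
Proof.
move=> lA; have [lt [D [wf tot Dc Dseg]]] := ch_well_order CH.
have [h hsurj] : exists h : set nat -> set nat, set_surj D setT h.
  by apply/pcard_surjP; move: Dc; rewrite card_eq_le => /andP[].
(* A set of naturals codes a sequence of sets of integers, so [D] can index all such sequences. *)
pose X x (n : nat) : set int := [set z | h x (pickle (n, z))].
have Xsurj (Y : nat -> set int) : exists2 x, D x & X x = Y.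
  have [x Dx hx] := hsurj [set m | exists n z, m = pickle (n, z) /\ Y n z] I.
  exists x => //; apply/funext => n; apply/seteqP; rewrite /X hx; split => z /=.
    by move=> [n' [z' [/(pcan_inj pickleK)[-> ->]]]].
  by move=> Ynz; exists n, z.
have [g gP] := schur_tower X wf tot Dseg lA.
pose v : set_system int := [set B | exists2 x, D x & almost_subset (g x) B].
have glarge B : v B -> schur_large B.
  by move=> [x /gP[lg _ _ _] gB]; exact: schur_large_almost gB lg.
have vfin B : v B -> ~ finite_set B.
  by move=> /glarge lB /finite_not_schur_large.
have gcomp x y : D x -> D y ->
    almost_subset (g x) (g y) \/ almost_subset (g y) (g x).
  move=> Dx Dy; have [xy|->|yx] := tot x y.
  - by right; have [_ _ _ /(_ x Dx xy)] := gP y Dy.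
  - by left; exact: sub_almost_subset.
  - by left; have [_ _ _ /(_ y Dy yx)] := gP x Dx.
have vA : v A.
  by have [x Dx _] := Xsurj (fun=> A); exists x => //; have [] := gP x Dx.
have vS B C : B `<=` C -> v B -> v C.
  move=> BC [x Dx gB]; exists x => //; apply: almost_subset_trans gB _.
  exact: sub_almost_subset.
have vF : ProperFilter v.
  split; first by move=> /vfin; apply; exact: finite_set0.
  split; [exact: vS vA|move=> B C [x Dx xB] [y Dy yC]|exact: vS].
  have [xy|yx] := gcomp x y Dx Dy.
    by exists x => //; apply: almost_subsetI (almost_subset_trans xy yC).
  by exists y => //; apply: almost_subsetI yC; exact: almost_subset_trans yx xB.
(* Deciding the constant sequence [B] decides [B] itself. *)
have vdec B : v B \/ v (~` B).
  have [x Dx xB] := Xsurj (fun=> B); have [_ _ + _] := gP x Dx.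
  rewrite /decides xB => -[/(_ 0) gB|[n gB]]; [left|right]; exists x => //.
  apply: sub_almost_subset => z /gB; apply: contra_not => Bz k _; exact: Bz.
have vU : UltraFilter v.
  split => // G GF vG; apply/seteqP; split => // B GB.
  have [//|/vG GnB] := vdec B.
  by have [z []] := filter_ex (filterI GB GnB).
exists (Ultrafilter v vU) => //; split.
- apply/seteqP; split => // z /(_ (~` [set z])) zv; apply: zv => //=.
  have [/vfin|//] := vdec [set z]; by case.
- move=> B /glarge /(_ unit (fun=> tt))[a [b [_ Ba Bb Bab _]]].
  by exists a, b.
- move=> U vUn; have [x Dx xU] := Xsurj U; exists (g x).
    by exists x => //; exact: sub_almost_subset.
  (* The second alternative would put into [v] the complement of a finite intersection of
     members. *)
  have [_ _ + _] := gP x Dx; rewrite /decides xU => -[//|[n gn]].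
  have vI : v (\bigcap_(k in `I_n) U k).
    elim: n {gn} => [|n IH]; first by apply: vS vA => z _ k /=; rewrite ltn0.
    by rewrite IIS bigcap_setU bigcap_set1; apply: filterI IH (vUn n).
  have vN : v (~` \bigcap_(k in `I_n) U k).
    by exists x => //; exact: sub_almost_subset.
  by have [z []] := filter_ex (filterI vI vN).
Qed.

(* [Sch] is coerced to the type of its elements, which carries the subspace
   topology; [set_val] is its inclusion into [ultrafilter int]. *)
Theorem theorem1p5 (CH : continuum_hypothesis) :
  dense ([set u : Sch | Schp (set_val u)] : set Sch).
Proof.
move=> O [u Ou] [U oU UO].
case: oU => B _ BU; move: Ou; rewrite -{}UO -{}BU => -[A BA uA].
have Su : Sch (set_val u) by exact: set_valP.
have [v vA vS] := schur_tower_ultrafilter CH (schur_large_ultrafilter Su uA).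
have Sv : Sch v by case: vS.
exists (SigSub (mem_set Sv)); split; first by exists A.
exact: vS.
Qed.
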